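(* Let $(X,d)$ be a locally compact, incomplete, rectifiably connected metric space with quasihyperbolic metric $k$, and let $x_0\in X$. Then $X$ is quasihyperbolic $a$-John with center $x_0$ for some $a\ge 1$ if and only if there is a constant $A\ge 1$ such that both of the following hold: (1) $A\,d(x_0)\ge \operatorname{diam}(X)$; (2) for every $x\in X$ and every quasihyperbolic geodesic $\alpha$ between $x$ and $x_0$: if $y_1,y_2\in\alpha$ satisfy $d(u)\le 2\min\{d(y_1),d(y_2)\}$ for each $u\in\alpha[y_1,y_2]$, then $k(y_1,y_2)\le A$. Moreover, the constants $a$ and $A$ depend only on each other. That is, for each $a\ge1$ there is $A=A(a)\ge 1$, depending only on $a$, such that every $X$ that is quasihyperbolic $a$-John with center $x_0$ satisfies (1) and (2) with this $A$; and for each $A\ge1$ there is $a=a(A)\ge1$, depending only on $A$, such that every $X$ satisfying (1) and (2) with constant $A$ is quasihyperbolic $a$-John with center $x_0$.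
   Context: Let $(X,d)$ be a locally compact, incomplete, rectifiably connected metric space. Here rectifiably connected means that every two points are joined by a curve of finite $d$-length. Let $\bar X$ be the metric completion and $\partial X=\bar X\setminus X\neq\emptyset$ the metric boundary. For $x\in X$ write $d(x)=\operatorname{dist}(x,\partial X)$. $\ell(\gamma)$ denotes the $d$-length of a curve $\gamma$, and for an arc $\gamma$ and $u,v\in\gamma$, $\gamma[u,v]$ denotes the subarc of $\gamma$ with endpoints $u,v$. Quasihyperbolic metric: $k(x,y)=\inf_\gamma\int_\gamma \frac{|dz|}{d(z)}$, the infimum over all rectifiable curves $\gamma$ in $X$ with endpoints $x,y$, where $|dz|$ is the arc-length element with respect to $d$. It is part of the standing setting that $(X,k)$ is a complete, proper and geodesic metric space. A quasihyperbolic geodesic between $x$ and $y$ is a geodesic arc of $(X,k)$ with endpoints $x,y$, i.e. the image of an isometric embedding of $[0,k(x,y)]$ into $(X,k)$ joining $x$ to $y$. Cone arc: for $a\ge1$, an arc $\gamma$ in $X$ joining $x$ to $x_0$ is an $a$-cone arc if $\ell(\gamma[x,z])\le a\,d(z)$ for all $z\in\gamma$. Quasihyperbolic John: for $x_0\in X$ and $a\ge1$, $X$ is quasihyperbolic $a$-John with center $x_0$ if for each $x\in X$, every quasihyperbolic geodesic in $X$ joining $x$ to $x_0$ is an $a$-cone arc. *)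

(* Defs.v *)
From HB Require Import structures.
From mathcomp Require Import all_boot all_order all_algebra.
From mathcomp Require Import all_classical all_reals all_analysis.

Set Implicit Arguments.
Unset Strict Implicit.
Unset Printing Implicit Defensive.

Import Order.TTheory GRing.Theory Num.Theory.
Import numFieldNormedType.Exports.

Local Open Scope classical_set_scope.
Local Open Scope ring_scope.

(* A second metric on a carrier [T], and the metric space it defines:
   [T] itself is in general already a [metricType] for another distance, so
   the new structure is put on the alias [metric_space]. *)
Record metric_on (R : realType) (T : Type) := MetricOn {
  metric_dist :> T -> T -> R;
  metric_dist_xx : forall x, metric_dist x x = 0;
  metric_dist_eq : forall x y, metric_dist x y = 0 -> x = y;
  metric_dist_sym : forall x y, metric_dist x y = metric_dist y x;
  metric_dist_triangle : forall y x z,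
    metric_dist x z <= metric_dist x y + metric_dist y z }.

Definition metric_space (R : realType) (T : choiceType) (k : metric_on R T)
  : Type := T.

HB.instance Definition _ (R : realType) (T : choiceType) (k : metric_on R T) :=
  Choice.on (metric_space k).
HB.instance Definition _ (R : realType) (T : choiceType) (k : metric_on R T) :=
  @isMetric.Build R (metric_space k) k (metric_dist_xx k) (metric_dist_eq (m := k))
    (metric_dist_sym k) (metric_dist_triangle k).

(* The library's [completeType] also asks for a distinguished point. *)
Definition cauchy_complete (T : uniformType) : Prop :=
  forall F : set_system T, ProperFilter F -> cauchy F -> exists l : T, F --> l.

Definition proper_metric (R : realType) (M : metricType R) : Prop :=
  forall (x : M) (r : R), compact [set y : M | mdist x y <= r].

Definition geodesic (R : realType) (M : metricType R) (x y : M) (g : R -> M)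
  : Prop :=
  [/\ g 0 = x, g (mdist x y) = y
    & {in `[0, mdist x y] &, forall s t, mdist (g s) (g t) = `|s - t|}].

Definition geodesic_metric (R : realType) (M : metricType R) : Prop :=
  forall x y : M, exists g : R -> M, geodesic x y g.

Definition diam (R : realType) (M : metricType R) : \bar R :=
  ereal_sup (range (fun xy : M * M => (mdist xy.1 xy.2)%:E)).

Section Curves.
Context {R : realType} {X : metricType R}.

Definition is_curve (c : R -> X) (p q : R) : Prop :=
  p <= q /\ {within `[p, q], continuous c}.

Definition is_arc (c : R -> X) (p q : R) : Prop :=
  is_curve c p q /\ {in `[p, q] &, injective c}.

Definition polygonal_length (c : R -> X) (p q : R) (s : seq R) : R :=
  let F := c \o nth q (p :: s) in
  \sum_(0 <= n < size s) mdist (F n) (F n.+1).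

Definition curve_length (c : R -> X) (p q : R) : \bar R :=
  ereal_sup [set (polygonal_length c p q s)%:E | s in itv_partition p q].

Definition rectifiable_curve (c : R -> X) (p q : R) : Prop :=
  is_curve c p q /\ (curve_length c p q < +oo)%E.

Definition rectifiably_connected : Prop :=
  forall x y : X, exists (c : R -> X) (p q : R),
    [/\ rectifiable_curve c p q, c p = x & c q = y].

(* The point of the curve [c] at arc length [s] from its start [c p]; all the
   parameters [t] selected by the set yield the same point [c t]. *)
Definition arclength_param (c : R -> X) (p q s : R) : X :=
  c (xget p [set t | t \in `[p, q] /\ curve_length c p t = s%:E]).

Definition line_integral (rho : X -> R) (c : R -> X) (p q : R) : \bar R :=
  (\int[lebesgue_measure]_(s in `[0%R, fine (curve_length c p q)])
     (rho (arclength_param c p q s))%:E)%E.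

End Curves.

Arguments rectifiably_connected {R} X.

Record completion (R : realType) (X : metricType R) := Completion {
  completion_space :> metricType R;
  completion_map : X -> completion_space;
  completion_isometry : forall x y : X,
    mdist (completion_map x) (completion_map y) = mdist x y;
  completion_dense : dense (range completion_map);
  completion_complete : cauchy_complete completion_space }.

Arguments completion_map {R X} c x.

Section Quasihyperbolic.
Context {R : realType} {X : metricType R} (Xbar : completion X).

Definition boundary : set Xbar := ~` range (completion_map Xbar).

Definition bdist (x : X) : R :=
  inf [set mdist (completion_map Xbar x) z | z in boundary].

Definition quasihyperbolic (x y : X) : \bar R :=
  ereal_inf [set v | exists (c : R -> X) (p q : R),
    [/\ rectifiable_curve c p q, c p = x, c q = y
      & v = line_integral (fun z => (bdist z)^-1) c p q]].

(* The equation [qh_metric] says that the quasihyperbolic distance is finite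
   and is the metric [k]. *)
Record qh_setting (k : metric_on R X) : Prop := QhSetting {
  qh_locally_compact : locally_compact [set: X];
  qh_incomplete : ~ cauchy_complete X;
  qh_rectifiably_connected : rectifiably_connected X;
  qh_metric : forall x y : X, quasihyperbolic x y = (k x y)%:E;
  qh_complete : cauchy_complete (metric_space k);
  qh_proper : proper_metric (metric_space k);
  qh_geodesic_metric : geodesic_metric (metric_space k) }.

Definition qh_geodesic (k : metric_on R X) (x y : X) (g : R -> X) : Prop :=
  @geodesic R (metric_space k) x y g.

Definition cone_arc (a : R) (c : R -> X) (p q : R) : Prop :=
  is_arc c p q /\
  (forall t, t \in `[p, q] -> (curve_length c p t <= (a * bdist (c t))%:E)%E).

Definition qh_john (k : metric_on R X) (a : R) (x0 : X) : Prop :=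
  forall (x : X) (g : R -> X), qh_geodesic k x x0 g ->
    cone_arc a g 0 (k x x0).

Definition diam_bound (A : R) (x0 : X) : Prop :=
  (diam X <= (A * bdist x0)%:E)%E.

(* The subarc between [g s] and [g t] is the image of the parameters between
   [s] and [t], in either order. *)
Definition qh_subarc_bound (k : metric_on R X) (A : R) (x0 : X) : Prop :=
  forall (x : X) (g : R -> X), qh_geodesic k x x0 g ->
  forall s t, s \in `[0, k x x0] -> t \in `[0, k x x0] ->
    (forall u, u \in `[Num.min s t, Num.max s t] ->
       bdist (g u) <= 2 * Num.min (bdist (g s)) (bdist (g t))) ->
    k (g s) (g t) <= A.

End Quasihyperbolic.

(* Main.v *)
(* Comparing [1 / d] with a constant along a curve gives the two estimates that
   link the metrics: [mdist x y <= 2 * k x y * d x] when [k x y <= 1 / 2], and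
   [k (c p) (c q) <= length / b] when [b <= d] on the curve.

   John implies (1) and (2): geodesics ending at [x0] have length at most
   [a * d x0], which bounds the diameter; on a subarc as in (2) the cone condition
   bounds the length from above and [d] from below by multiples of [d y1].

   Conversely, let [f u = d (g u)] along a geodesic [g] ending at [x0].  By (1),
   [f] is nowhere much larger than at its end; a deep dip of [f] would thus have
   two ends at the same level, hence be short by (2), and then Harnack's inequality
   makes it shallow.  So [f] is increasing up to a constant factor.  Applying (2)
   scale by scale, [f] stays within a bounded range of scales only for a bounded
   time; hence [f] at least doubles after a fixed time, so it grows exponentially
   and the length of [g] up to time [t] is comparable to [f t]. *)

Require Import Defs.
From mathcomp Require Import all_boot all_order all_algebra.
From mathcomp Require Import all_classical all_reals all_analysis.
From mathcomp Require Import ring lra.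

Import Order.TTheory GRing.Theory Num.Theory.
Import numFieldNormedType.Exports.

Set Implicit Arguments.
Unset Strict Implicit.
Unset Printing Implicit Defensive.

Local Open Scope classical_set_scope.
Local Open Scope ring_scope.

(* A replacement for [ge0_le_integral]: the density integrated along a curve is
   not known to be measurable, but the integral of a nonnegative function is a
   supremum over the simple functions below it. *)
Lemma ge0_integral_mono d (T : measurableType d) (R : realType)
    (mu : {measure set T -> \bar R}) (D : set T) (f1 f2 : T -> \bar R) :
  (forall x, D x -> (0 <= f1 x)%E) -> (forall x, D x -> (f1 x <= f2 x)%E) ->
  (\int[mu]_(x in D) f1 x <= \int[mu]_(x in D) f2 x)%E.
Proof.
move=> f10 f12; have f20 x : D x -> (0 <= f2 x)%E.
  by move=> Dx; exact: le_trans (f10 x Dx) (f12 x Dx).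
rewrite !ge0_integralE//; apply: ereal_sup_le => _ [h hf <-]; exists h => // x.
apply: (le_trans (hf x)); rewrite /patch; case: ifPn => // xD.
by apply: f12; rewrite inE in xD.
Qed.

Lemma integral_cst_itv (R : realType) (L b : R) : 0 <= L ->
  (\int[lebesgue_measure]_(s in `[0%R, L]) b%:E = (b * L)%:E)%E.
Proof.
move=> L0.
have LE : lebesgue_measure (`[0, L]%classic : set R) = L%:E.
  rewrite lebesgue_measure_itv/= lte_fin; case: ltP => [_|L0'].
    by rewrite oppr0 adde0.
  by congr EFin; apply/eqP; rewrite eq_le L0 L0'.
by rewrite EFinM -LE; exact: (integral_cst lebesgue_measure (measurable_itv `[0, L])).
Qed.

(** * Curve length and line integrals *)

Section CurveLength.
Context {R : realType} {X : metricType R}.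
Implicit Types (c : R -> X) (H : R -> R).

Lemma polygonal_length_cons c (p q x : R) s :
  polygonal_length c p q (x :: s) =
  mdist (c p) (c x) + polygonal_length c x q s.
Proof. by rewrite /polygonal_length /= big_nat_recl. Qed.

Lemma mdist_le_curve_length c (p q : R) : p <= q ->
  ((mdist (c p) (c q))%:E <= curve_length c p q)%E.
Proof.
rewrite le_eqVlt => /predU1P[<-|pq]; apply: ereal_sup_ubound => /=.
  exists [::]; first by split.
  by rewrite /polygonal_length big_geq// mdistxx.
exists [:: q]; first exact: itv_partition1.
by rewrite polygonal_length_cons /polygonal_length big_geq// addr0.
Qed.

Lemma curve_length_ge0 c (p q : R) : p <= q -> (0 <= curve_length c p q)%E.
Proof.
move=> pq; apply: le_trans (mdist_le_curve_length c pq).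
by rewrite lee_fin mdist_ge0.
Qed.

Lemma curve_length_suffix c (p s q : R) : p <= s ->
  (curve_length c s q <= curve_length c p q)%E.
Proof.
rewrite le_eqVlt => /predU1P[->//|ps].
apply: ge_ereal_sup => _ [l sl <-].
apply: (@le_trans _ _ (polygonal_length c p q (s :: l))%:E).
  by rewrite polygonal_length_cons lee_fin lerDr mdist_ge0.
apply: ereal_sup_ubound; exists (s :: l) => //.
by case: sl => sl lq; split => //=; rewrite ps.
Qed.

(** [H] is a potential for the chords, whose sum telescopes along any partition. The cone estimate
    uses an exponential for [H]. *)
Lemma curve_length_le_increment c H (p q : R) :
  (forall u v, p <= u <= v -> v <= q -> mdist (c u) (c v) <= H v - H u) ->
  (curve_length c p q <= (H q - H p)%:E)%E.
Proof.
move=> cH; apply: ge_ereal_sup => _ [l pl <-]; rewrite lee_fin.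
elim: l p pl cH => [|x l IH] p pl cH.
  rewrite /polygonal_length big_geq//.
  by rewrite (itv_partition_nil pl) subrr.
have xl := itv_partition_cons pl; have xq := itv_partition_le xl.
have px : p < x by case: pl => /= /andP[].
rewrite polygonal_length_cons.
have : mdist (c p) (c x) <= H x - H p by apply: cH => //; rewrite lexx ltW.
have : polygonal_length c x q l <= H q - H x.
  by apply: IH => // u v uv vq; apply: cH => //; lra.
lra.
Qed.

(** Steps of size [e] are chained by the triangle inequality, because [k] bounds the original metric
    linearly only at small scale. *)
Lemma increment_local_to_global c H (p q e : R) : 0 < e ->
  (forall u v, p <= u <= v -> v <= q -> v - u <= e ->
    mdist (c u) (c v) <= H v - H u) ->
  forall u v, p <= u <= v -> v <= q -> mdist (c u) (c v) <= H v - H u.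
Proof.
move=> e0 cH u v puv vq.
have [N] : exists N : nat, v - u <= N%:R * e.
  exists (Num.bound ((v - u) / e)); rewrite -ler_pdivrMr//.
  by apply/ltW/archi_boundP/divr_ge0; lra.
elim: N u puv => [|N IH] u puv uN; first by apply: cH => //; lra.
have [h|h] := leP (v - u) e; first exact: cH.
rewrite -natr1 mulrDl mul1r in uN.
have := IH (u + e) ltac:(lra) ltac:(lra).
have := cH u (u + e) ltac:(lra) ltac:(lra) ltac:(lra).
have := metric_triangle (c u) (c (u + e)) (c v).
lra.
Qed.

Lemma arclength_param_range c (p q s : R) : p <= q ->
  exists2 t, p <= t <= q & c t = arclength_param c p q s.
Proof.
move=> pq; rewrite /arclength_param.
case: xgetP => [t _ []|_]; first by rewrite in_itv/= => pt _; exists t.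
(* When no parameter has arc length [s], the default [p] of [xget] still gives a point of the
   curve. *)
by exists p => //; rewrite lexx.
Qed.

Lemma arclength_param_dist c (p q s : R) : 0 <= s ->
  mdist (c p) (arclength_param c p q s) <= s.
Proof.
move=> s0; rewrite /arclength_param.
case: xgetP => [t _ []|_]; last by rewrite mdistxx.
rewrite in_itv/= => /andP[pt _] ts.
by rewrite -lee_fin -ts; exact: mdist_le_curve_length.
Qed.

Lemma line_integral_le (rho : X -> R) c (p q b : R) : p <= q ->
  (curve_length c p q < +oo)%E ->
  (forall t, p <= t <= q -> 0 <= rho (c t) <= b) ->
  (line_integral rho c p q <= b%:E * curve_length c p q)%E.
Proof.
move=> pq Loo rb; have L0 := curve_length_ge0 c pq.
have LE : curve_length c p q = (fine (curve_length c p q))%:E.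
  by rewrite fineK// ge0_fin_numE.
rewrite [in leRHS]LE /line_integral -EFinM -integral_cst_itv ?fine_ge0//.
apply: ge0_integral_mono => s _; have [t pt <-] := arclength_param_range c s pq;
  rewrite lee_fin; by have /andP[] := rb t pt.
Qed.

(** The point at arc length [s] is within [s] of [c p], so a bound for [rho] on a ball about the
    start is enough. *)
Lemma le_line_integral (rho : X -> R) c (p q b : R) : p <= q ->
  (curve_length c p q < +oo)%E -> 0 <= b ->
  (forall z, mdist (c p) z <= fine (curve_length c p q) -> b <= rho z) ->
  (b%:E * curve_length c p q <= line_integral rho c p q)%E.
Proof.
move=> pq Loo b0 rb; have L0 := curve_length_ge0 c pq.
have LE : curve_length c p q = (fine (curve_length c p q))%:E.
  by rewrite fineK// ge0_fin_numE.
rewrite [in leLHS]LE /line_integral -EFinM -integral_cst_itv ?fine_ge0//.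
apply: ge0_integral_mono => s; rewrite /= in_itv/= => /andP[s0 sL].
  by rewrite lee_fin.
by rewrite lee_fin; apply: rb; apply: le_trans sL; exact: arclength_param_dist.
Qed.

End CurveLength.

(** * Growth of a Harnack function with short plateaus *)

Lemma expR_half_le2 (R : realType) : expR (2^-1) <= 2 :> R.
Proof.
have := expR_ge1Dx (- 2^-1 : R).
rewrite expRN => h.
have e0 := @expR_gt0 R (2^-1).
rewrite -[2]invrK -(lef_pV2); last 2 first.
- by rewrite posrE invr_gt0 invr_gt0; lra.
- by rewrite posrE.
by rewrite invrK; lra.
Qed.

(** The factor [1 + A] compares [f] with its end value; the exponential is Harnack's factor across a
    dip of length at most [A]. *)
Definition dip_ratio (R : realType) (A : R) : R := (1 + A) * expR (2 * A).

Fixpoint scale_time (R : realType) (A : R) (n : nat) : R :=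
  if n is n'.+1 then 2 * scale_time A n' + A else A.

Section Profile.
Context {R : realType} (A K : R) (f : R -> R).
Hypothesis f_gt0 : forall u : R, 0 <= u <= K -> 0 < f u.
Hypothesis f_harnack : forall u v : R, 0 <= u <= K -> 0 <= v <= K ->
  f v <= f u * expR (2 * `|u - v|).
Hypothesis f_end : forall u : R, 0 <= u <= K -> f u <= (1 + A) * f K.
Hypothesis f_plateau : forall s t : R, 0 <= s <= t -> t <= K ->
  (forall u : R, s <= u <= t -> f u <= 2 * f s /\ f u <= 2 * f t) -> t - s <= A.
Hypothesis A_ge1 : 1 <= A.

Lemma harnack_quarter (u v : R) : 0 <= u <= K -> 0 <= v <= K ->
  `|u - v| <= 4^-1 -> f v <= 2 * f u.
Proof.
move=> uK vK uv; apply: (le_trans (f_harnack uK vK)).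
rewrite mulrC ler_wpM2r ?(ltW (f_gt0 uK))//.
apply: (le_trans _ (expR_half_le2 R)); rewrite ler_expR; lra.
Qed.

(** Harnack's inequality stands in for continuity: [v] lies within 1/4 of the supremum of the points
    with [rho <= f], so moving right by 1/4 from any later point passes that supremum or reaches
    [t], at the cost of a factor 2. *)
Lemma last_exit (u t rho : R) : 0 <= u <= t -> t <= K -> rho <= f u -> f t < rho ->
  exists v, [/\ u <= v <= t, rho <= f v &
    forall w, v <= w <= t -> f w <= 2 * rho].
Proof.
move=> ut tK fu ft.
pose S := [set v | u <= v <= t /\ rho <= f v].
have supS : has_sup S.
  by split; [exists u; split=> //; lra | exists t => v [/andP[]]].
have [|v [uvt fv] vS] := @sup_adherent R S 4^-1 _ supS; first by rewrite invr_gt0.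
exists v; split=> // w vwt.
have [wt|wt] := leP (w + 4^-1) t.
  apply: (@le_trans _ _ (2 * f (w + 4^-1))).
    by apply: harnack_quarter; rewrite ?ger0_norm; lra.
  rewrite ler_pM2l// leNgt; apply/negP => /ltW h.
  have := ub_le_sup supS.2 (_ : S (w + 4^-1)).
  have : S (w + 4^-1) by split=> //; lra.
  by move=> Sw /(_ Sw); lra.
apply: (@le_trans _ _ (2 * f t)); last lra.
by apply: harnack_quarter; rewrite ?ger0_norm; lra.
Qed.

Lemma first_entry (t u rho : R) : 0 <= t <= u -> u <= K -> rho <= f u -> f t < rho ->
  exists v, [/\ t <= v <= u, rho <= f v &
    forall w, t <= w <= v -> f w <= 2 * rho].
Proof.
move=> tu uK fu ft.
pose S := [set v | t <= v <= u /\ rho <= f v].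
have infS : has_inf S.
  by split; [exists u; split=> //; lra | exists t => v [/andP[]]].
have [|v [uvt fv] vS] := @inf_adherent R S 4^-1 _ infS; first by rewrite invr_gt0.
exists v; split=> // w vwt.
have [wt|wt] := leP t (w - 4^-1).
  apply: (@le_trans _ _ (2 * f (w - 4^-1))).
    by apply: harnack_quarter; rewrite ?ler0_norm; lra.
  rewrite ler_pM2l// leNgt; apply/negP => /ltW h.
  have := ge_inf infS.2 (_ : S (w - 4^-1)).
  have : S (w - 4^-1) by split=> //; lra.
  by move=> Sw /(_ Sw); lra.
apply: (@le_trans _ _ (2 * f t)); last lra.
by apply: harnack_quarter; rewrite ?ler0_norm; lra.
Qed.

(* Let [rho] be the smaller of [f u] and [f K]: if [f] dips below [rho] at [t],
   the two ends of the dip satisfy the plateau condition, so the dip is short,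
   and Harnack's inequality bounds its depth. *)
Lemma almost_increasing (u t : R) : 0 <= u <= t -> t <= K -> f u <= dip_ratio A * f t.
Proof.
have A1 := A_ge1.
move=> ut tK.
have tK0 : 0 <= t <= K by lra.
have uK0 : 0 <= u <= K by lra.
have e1 : 1 <= expR (2 * A) by have := expR_ge1Dx (2 * A); lra.
have ft0 := f_gt0 tK0.
pose rho := Num.min (f u) (f K).
have fu : f u <= (1 + A) * rho.
  rewrite /rho; have := f_end uK0; have := f_gt0 uK0.
  by case: (leP (f u) (f K)) => *; nra.
have rt : rho <= f t * expR (2 * A).
  have [rt|rt] := leP rho (f t); first by nra.
  have [|v [uvt fv v2]] := last_exit ut tK _ rt; first by rewrite ge_min lexx.
  have [| | |w [tw fw w2]] := @first_entry t K rho _ _ _ rt; [lra|lra| |].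
    by rewrite ge_min lexx orbT.
  have wv : w - v <= A.
    apply: f_plateau; [lra|lra|move=> x xvw].
    have : f x <= 2 * rho.
      by have [xt|tx] := leP x t; [apply: v2|apply: w2]; lra.
    lra.
  apply: (le_trans fv); apply: le_trans (f_harnack tK0 (_ : 0 <= v <= K)) _.
    lra.
  rewrite ler_pM2l// ler_expR ger0_norm; lra.
rewrite /dip_ratio -mulrA; apply: (le_trans fu); rewrite ler_pM2l; [|lra].
by rewrite mulrC.
Qed.

Lemma scale_time_ge n : A <= scale_time A n.
Proof. by have A1 := A_ge1; elim: n => //= n IH; lra. Qed.

(* If the interval were longer, its two end pieces of length [scale_time A n]
   would both reach the top octave [f > 2 ^+ n * m], at points more than [A]
   apart. *)
Lemma scale_time_bound n (m s t : R) : 0 <= s <= t -> t <= K ->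
  (forall u, s <= u <= t -> m <= f u <= 2 ^+ n * m) -> t - s <= scale_time A n.
Proof.
have A1 := A_ge1.
elim: n s t => [|n IH] s t st tK fm.
  rewrite /=; apply: f_plateau => // u sut.
  have := fm u sut; have := fm s; have := fm t.
  have : 0 < f u by apply: f_gt0; lra.
  rewrite expr0 mul1r; lra.
rewrite leNgt /=; apply/negP => tst.
have TA := scale_time_ge n.
(* A third of the excess length: each end piece becomes longer than [scale_time A n] by [e], and the
   gap between them is still [A + e]. *)
pose e := (t - s - (2 * scale_time A n + A)) / 3.
have e0 : 0 < e by rewrite /e; lra.
have top p q : s <= p -> p + (scale_time A n + e) = q -> q <= t ->
    exists2 v, p <= v <= q & 2 ^+ n * m < f v.
  move=> sp pq qt; apply: contrapT => nv.
  suff : q - p <= scale_time A n by lra.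
  apply: IH; [lra|lra|move=> u upq].
  apply/andP; split; first by have /andP[] := fm u ltac:(lra).
  by rewrite leNgt; apply/negP => h; apply: nv; exists u.
have [| | |v v1 fv] := top s (s + (scale_time A n + e)); [lra|lra|rewrite /e; lra|].
have [| | |w w1 fw] := top (t - (scale_time A n + e)) t; [rewrite /e; lra|lra|lra|].
suff : w - v <= A by rewrite /e in v1 w1 e0; lra.
have vw : v <= w by rewrite /e in v1 w1 e0; lra.
apply: f_plateau => [||u uvw]; [lra|lra|].
have /andP[_] := fm u ltac:(lra).
by rewrite exprS; lra.
Qed.

(** Otherwise [almost_increasing] at both ends confines [f] on the interval to a ratio of
    [2 * dip_ratio A ^+ 2], hence to [n] octaves, for longer than [scale_time_bound] allows. *)
Lemma halving n (t : R) : 2 * dip_ratio A ^+ 2 <= 2 ^+ n -> scale_time A n + 1 <= t <= K ->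
  f (t - (scale_time A n + 1)) <= f t / 2.
Proof.
have A1 := A_ge1.
move=> Cn; set T := scale_time A n + 1 => tK.
have TA := scale_time_ge n.
have C0 : 0 < dip_ratio A.
  by rewrite /dip_ratio mulr_gt0// ?expR_gt0//; lra.
have s0 : 0 < f (t - T) by apply: f_gt0; rewrite /T in tK *; lra.
have t0 : 0 < f t by apply: f_gt0; rewrite /T in tK *; lra.
rewrite leNgt; apply/negP => ht.
suff : t - (t - T) <= scale_time A n by rewrite /T; lra.
apply: (@scale_time_bound n (f (t - T) / dip_ratio A)); [rewrite /T in tK *; lra|lra|].
move=> u ut; apply/andP; split.
  rewrite ler_pdivrMr// mulrC; apply: almost_increasing; rewrite /T in tK ut *; lra.
apply: (@le_trans _ _ (dip_ratio A * f t)).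
  by apply: almost_increasing; rewrite /T in tK ut *; lra.
rewrite mulrA ler_pdivlMr//.
have : 2 * dip_ratio A ^+ 2 * f (t - T) <= 2 ^+ n * f (t - T) by rewrite ler_pM2r.
have : dip_ratio A ^+ 2 * f t <= dip_ratio A ^+ 2 * (2 * f (t - T)).
  by rewrite ler_wpM2l ?exprn_ge0 ?(ltW C0)//; lra.
rewrite expr2; lra.
Qed.

(** [halving] is iterated in steps of length [T]. The rate is 1 / (2T) because a step gains 2, which
    is at least exp(1/2); the leading 2 pays for a last incomplete step. *)
Lemma exponential_growth n (u t : R) : 2 * dip_ratio A ^+ 2 <= 2 ^+ n -> 0 <= u <= t -> t <= K ->
  f u <= 2 * dip_ratio A * expR (- (t - u) / (2 * (scale_time A n + 1))) * f t.
Proof.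
have A1 := A_ge1.
move=> Cn ut tK; set T := scale_time A n + 1.
have TA := scale_time_ge n.
have T0 : 0 < T by rewrite /T; lra.
have C0 : 0 < dip_ratio A.
  by rewrite /dip_ratio mulr_gt0// ?expR_gt0//; lra.
have expT x : 2^-1 <= expR (- x / (2 * T)) \/ T < x.
  have [xT|] := leP x T; [left|by right].
  rewrite mulNr expRN lef_pV2 ?posrE ?expR_gt0//.
  by apply: le_trans (expR_half_le2 R); rewrite ler_expR ler_pdivrMr; lra.
have [N] : exists N : nat, t - u <= N%:R * T.
  exists (Num.bound ((t - u) / T)); rewrite -ler_pdivrMr//.
  by apply/ltW/archi_boundP/divr_ge0; lra.
elim: N u ut => [|N IH] u ut tuN.
  have -> : u = t by rewrite mul0r in tuN; lra.
  apply: (@le_trans _ _ (dip_ratio A * f t)); first by apply: almost_increasing; lra.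
  rewrite subrr oppr0 mul0r expR0; have : 0 < f t by apply: f_gt0; lra.
  by move=> ft; have := mulr_gt0 C0 ft; lra.
have ft : 0 < f t by apply: f_gt0; lra.
have [h|h] := expT (t - u).
  apply: (@le_trans _ _ (dip_ratio A * f t)); first exact: almost_increasing.
  rewrite ler_pM2r// mulrAC ler_pMl//; lra.
have := IH (u + T); rewrite -natr1 mulrDl mul1r in tuN => /(_ ltac:(lra) ltac:(lra)).
have := @halving n (u + T) Cn; rewrite -/T addrK => /(_ ltac:(lra)) h1 h2.
have eT : expR (- (t - (u + T)) / (2 * T)) =
    expR (- (t - u) / (2 * T)) * expR (2^-1).
  by rewrite -expRD; congr expR; field; rewrite gt_eqF.
apply: (le_trans h1); rewrite ler_pdivrMr//; apply: (le_trans h2).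
have := mulr_gt0 (mulr_gt0 C0 (expR_gt0 (- (t - u) / (2 * T)))) ft.
by rewrite eT => /ltW/ler_wpM2l/(_ _ _ (expR_half_le2 R)); lra.
Qed.
End Profile.

(** * Distance to the boundary *)

Section BoundaryDistance.
Context {R : realType} {X : metricType R} (Xbar : completion X).
Hypothesis X_incomplete : ~ cauchy_complete X.
Hypothesis X_locally_compact : locally_compact [set: X].

(** If the completion map were onto, limits of Cauchy filters would pull back to [X] along the
    isometry. Hence the infimum defining [bdist] is over a nonempty set. *)
Lemma boundary_nonempty : @boundary R X Xbar !=set0.
Proof.
apply: contrapT => /forallNP noboundary; apply: X_incomplete => F FF cF.
have onto z : exists x, completion_map Xbar x = z.
  by apply: contrapT => nz; apply: (noboundary z) => -[x _ xz]; apply: nz; exists x.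
have [] := @completion_complete _ _ Xbar (completion_map Xbar @ F).
  apply/cauchy_exP => e e0; have /cauchyP/(_ e e0)[x Fx] := cF.
  exists (completion_map Xbar x); rewrite /fmap/=; apply: filterS Fx => y.
  by rewrite /= !ballEmdist/= completion_isometry.
move=> l; have [x <-] := onto l => /metricType_numDomainType.cvgrPdist_lt Fl.
exists x; apply/metricType_numDomainType.fcvgrPdist_lt => e e0.
by apply: filterS (Fl e e0) => y; rewrite completion_isometry.
Qed.

Lemma completion_map_continuous : continuous (completion_map Xbar).
Proof.
move=> x; apply/metricType_numDomainType.cvgrPdist_lt => e e0; near=> y.
rewrite completion_isometry; near: y.
by apply: metricType_numDomainType.cvgr_dist_lt.
Unshelve. all: by end_near. Qed.

Let has_inf_dist x : has_inf [set mdist (completion_map Xbar x) z | z in @boundary R X Xbar].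
Proof.
have [z bz] := boundary_nonempty; split.
  by exists (mdist (completion_map Xbar x) z); exists z.
by exists 0 => _ [w _ <-]; exact: mdist_ge0.
Qed.

Lemma bdist_lipschitz x y : bdist Xbar y <= bdist Xbar x + mdist x y.
Proof.
rewrite -lerBlDr; apply: lb_le_inf; first exact: (has_inf_dist x).1.
move=> _ [z bz <-]; rewrite lerBlDr.
apply: le_trans (ge_inf (has_inf_dist y).2 _) _; first by exists z.
rewrite -(completion_isometry Xbar) addrC (metric_sym (completion_map Xbar x)).
exact: metric_triangle.
Qed.

(* A compact neighbourhood of [x] has a closed image in the completion, so a
   boundary point cannot be approximated by points of [X] near [x]. *)
Lemma bdist_gt0 x : 0 < bdist Xbar x.
Proof.
have [U] := X_locally_compact (I : [set: X] x).
rewrite withinET => Ux [cU _].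
have /metricType_numDomainType.nbhs_mdistP[r /= r0 rU] := Ux.
have clU : closed (completion_map Xbar @` U).
  apply: compact_closed; first exact: metric_hausdorff.
  by apply: continuous_compact => //; apply: continuous_subspaceT;
     exact: completion_map_continuous.
suff : r / 2 <= bdist Xbar x by apply: lt_le_trans; rewrite divr_gt0.
apply: lb_le_inf; first exact: (has_inf_dist x).1.
move=> _ [z bz <-]; rewrite leNgt; apply/negP => xz; apply: bz.
suff [y _ yz] : (completion_map Xbar @` U) z by exists y.
apply: clU => B /metricType_numDomainType.nbhs_mdistP[e /= e0 eB].
have m0 : 0 < Num.min e (r / 2) by rewrite lt_min e0 divr_gt0.
have [|w [zw [y _ yw]]] :=
    @completion_dense _ _ Xbar _ _ (open_interior (ball z (Num.min e (r / 2)))).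
  by exists z; exact: nbhsx_ballx.
exists w; move/interior_subset: zw; rewrite ballEmdist/= lt_min -yw => /andP[zye zyr].
split; last by apply: eB; rewrite /= .
exists y => //; apply: rU; rewrite /= -(completion_isometry Xbar).
apply: le_lt_trans (metric_triangle _ z _) _.
by rewrite [ltRHS](splitr r) ltrD.
Qed.

End BoundaryDistance.
(** * Quasihyperbolic geodesics *)

Section Geodesics.
Context {R : realType} {X : metricType R} (Xbar : completion X) (k : metric_on R X).
Hypothesis setting : qh_setting Xbar k.

Let d := bdist Xbar.

Let d_gt0 x : 0 < d x.
Proof. by case: setting => *; exact: bdist_gt0. Qed.

Let d_lipschitz x y : d y <= d x + mdist x y.
Proof. by case: setting => *; exact: bdist_lipschitz. Qed.

(* Along a curve of length [L] issued from [x] the density [1 / d] is at least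
   [1 / (d x + L)]. *)
Lemma qh_ge x y : mdist x y / (d x + mdist x y) <= k x y.
Proof.
have dx := d_gt0 x; have m0 := mdist_ge0 x y.
rewrite -lee_fin -(qh_metric setting); apply: le_ereal_inf_tmp.
move=> _ [c [p [q [[[pq _] Loo] cp cq ->]]]].
have L0 := curve_length_ge0 c pq.
have LE : curve_length c p q = (fine (curve_length c p q))%:E.
  by rewrite fineK// ge0_fin_numE.
set L := fine (curve_length c p q) in LE *.
have mL : mdist x y <= L.
  by rewrite -lee_fin -LE -cp -cq; exact: mdist_le_curve_length.
apply: (@le_trans _ _ ((d x + L)^-1%:E * curve_length c p q)%E).
  rewrite LE -EFinM lee_fin [leRHS]mulrC ler_pdivrMr; last lra.
  rewrite mulrAC ler_pdivlMr; last lra.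
  have : d x * mdist x y <= d x * L by rewrite ler_pM2l.
  lra.
apply: le_line_integral => //; first by rewrite invr_ge0; lra.
move=> z; rewrite -/L cp => xz; have dz := d_gt0 z; have := d_lipschitz x z.
by move=> dxz; rewrite lef_pV2 ?posrE//; lra.
Qed.

(** In [qh_ge] multiplied out, the term [k x y * mdist x y] is at most half of [mdist x y] and is
    absorbed. *)
Lemma mdist_le_qh x y : k x y <= 2^-1 -> mdist x y <= 2 * k x y * d x.
Proof.
move=> k2; have dx := d_gt0 x; have m0 := mdist_ge0 x y.
have := qh_ge x y; rewrite ler_pdivrMr; last lra.
have : k x y * mdist x y <= 2^-1 * mdist x y by exact: ler_wpM2r.
lra.
Qed.

Lemma qh_le (c : R -> X) (p q b : R) : is_curve c p q ->
  (curve_length c p q < +oo)%E -> 0 < b -> (forall t, p <= t <= q -> b <= d (c t)) ->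
  ((k (c p) (c q))%:E <= b^-1%:E * curve_length c p q)%E.
Proof.
move=> cc Loo b0 bd; apply: (@le_trans _ _ (line_integral (fun z => (d z)^-1) c p q)).
  by rewrite -(qh_metric setting); apply: ereal_inf_lbound; exists c, p, q.
apply: line_integral_le => //; first by case: cc.
move=> t /bd bt; rewrite invr_ge0 ltW//= lef_pV2 ?posrE//.
Qed.

Lemma qh_ge0 x y : 0 <= k x y.
Proof. exact: (@mdist_ge0 R (metric_space k)). Qed.

Section Geodesic.
Variables (x y : X) (g : R -> X).
Hypothesis geo : qh_geodesic k x y g.

Lemma qh_geodesic_dist (u v : R) : 0 <= u <= k x y -> 0 <= v <= k x y ->
  k (g u) (g v) = `|u - v|.
Proof. by case: geo => _ _ gE uK vK; apply: gE; rewrite in_itv. Qed.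

Lemma qh_geodesic_mdist (u v : R) : 0 <= u <= k x y -> 0 <= v <= k x y ->
  `|u - v| <= 2^-1 -> mdist (g u) (g v) <= 2 * `|u - v| * d (g u).
Proof.
move=> uK vK uv; rewrite -(qh_geodesic_dist uK vK).
by apply: mdist_le_qh; rewrite qh_geodesic_dist.
Qed.

(** Bisection down to length 1/2, where the Lipschitz bound gives the factor 1 + 2|u - v|; the
    exponentials of the two halves multiply. *)
Lemma qh_geodesic_harnack (u v : R) : 0 <= u <= k x y -> 0 <= v <= k x y ->
  d (g v) <= d (g u) * expR (2 * `|u - v|).
Proof.
have [N] : exists N : nat, `|u - v| <= 2 ^+ N * 2^-1.
  exists (Num.bound (2 * `|u - v|)); rewrite ler_pdivlMr// mulrC.
  apply/ltW/(@lt_le_trans _ _ (Num.bound (2 * `|u - v|))%:R).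
    by apply: archi_boundP; rewrite mulr_ge0.
  by rewrite -natrX ler_nat ltnW// ltn_expl.
elim: N u v => [|N IH] u v uvN uK vK.
  rewrite expr0 mul1r in uvN.
  have := qh_geodesic_mdist uK vK uvN; have := d_lipschitz (g u) (g v).
  have := ler_wpM2l (ltW (d_gt0 (g u))) (expR_ge1Dx (2 * `|u - v|)); lra.
pose w := (u + v) / 2.
have uw : `|u - w| = `|u - v| / 2.
  have -> : u - w = (u - v) / 2 by rewrite /w; lra.
  by rewrite normrM [`|2^-1|]ger0_norm.
have wv : `|w - v| = `|u - v| / 2.
  have -> : w - v = (u - v) / 2 by rewrite /w; lra.
  by rewrite normrM [`|2^-1|]ger0_norm.
have wK : 0 <= w <= k x y by rewrite /w; lra.
rewrite exprS in uvN.
have := IH u w ltac:(rewrite uw; lra) uK wK.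
have := IH w v ltac:(rewrite wv; lra) wK vK.
rewrite uw wv (_ : 2 * (`|u - v| / 2) = `|u - v|); last lra.
move=> h1 h2; apply: (le_trans h1).
have -> : 2 * `|u - v| = `|u - v| + `|u - v| by lra.
by rewrite expRD mulrA ler_pM2r ?expR_gt0.
Qed.

Lemma qh_geodesic_is_arc : is_arc g 0 (k x y).
Proof.
split; last first.
  move=> u v; rewrite !in_itv/= => uK vK guv.
  have := qh_geodesic_dist uK vK; rewrite guv (metric_dist_xx k).
  by move=> /esym/eqP; rewrite normr_eq0 subr_eq0 => /eqP.
split; first exact: qh_ge0.
apply/subspace_continuousP => u /=; rewrite in_itv/= => uK.
apply/metricType_numDomainType.cvgrPdist_lt => e e0.
have du := d_gt0 (g u).
have m0 : 0 < Num.min 2^-1 (e / (2 * d (g u))).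
  by rewrite lt_min invr_gt0 ltr0n/= divr_gt0// mulr_gt0.
rewrite near_withinE; near=> v => /=; rewrite in_itv/= => vK.
have : `|u - v| < Num.min 2^-1 (e / (2 * d (g u))).
  by near: v; exact: (@cvgr_dist_lt _ _ _ _ _ id).
rewrite lt_min => /andP[uv2 uve].
apply: le_lt_trans (qh_geodesic_mdist uK vK (ltW uv2)) _.
by rewrite mulrAC mulrC -ltr_pdivlMr// mulr_gt0.
Unshelve. all: by end_near. Qed.

End Geodesic.
End Geodesics.
(** * The two implications *)

Section JohnImpliesBounds.
Context {R : realType} {X : metricType R} (Xbar : completion X) (k : metric_on R X).
Variables (a : R) (x0 : X).
Hypotheses (setting : qh_setting Xbar k) (a_ge1 : 1 <= a)
  (john : qh_john Xbar k a x0).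

Let d := bdist Xbar.

(** The cone condition at the end [x0] puts every point within [a * d x0] of [x0]. The constant is
    chosen to agree with that of the subarc bound. *)
Lemma john_diam_bound : diam_bound Xbar (2 * a * (1 + a)) x0.
Proof.
have a1 := a_ge1; have dx0 : 0 < d x0.
  by case: setting => *; exact: bdist_gt0.
have ad : 0 < a * d x0 by rewrite mulr_gt0//; lra.
have star x : mdist x x0 <= a * d x0.
  have [g geo] := qh_geodesic_metric setting x x0.
  have [_ cone] := john geo; case: (geo) => g0 gK _.
  have kK : k x x0 \in `[0, k x x0] by rewrite in_itv/= lexx qh_ge0.
  rewrite -lee_fin; have := @mdist_le_curve_length R X g _ _ (qh_ge0 k x x0).
  rewrite g0 (gK : g (k x x0) = x0) => /le_trans; apply.
  by have := cone _ kK; rewrite (gK : g (k x x0) = x0).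
apply: ge_ereal_sup => _ [[x y] _ <-]/=; rewrite lee_fin.
have := star x; have := star y; have := metric_triangle x x0 y.
rewrite (metric_sym x0 y) -/(d x0); have := mulr_gt0 ad (lt_le_trans ltr01 a1).
lra.
Qed.

(* On the subarc the cone condition gives [d u >= d (g s) / (1 + a)], while the
   length of the subarc is at most [a * d (g t) <= 2 * a * d (g s)]. *)
Lemma john_ordered_subarc_bound x g (s t : R) : qh_geodesic k x x0 g ->
  0 <= s <= t -> t <= k x x0 -> d (g t) <= 2 * d (g s) ->
  k (g s) (g t) <= 2 * a * (1 + a).
Proof.
move=> geo st tK dts; have a1 := a_ge1.
have d0 z : 0 < d z by case: setting => *; exact: bdist_gt0.
have [_ cone] := john geo.
have [[_ gcont] _] := qh_geodesic_is_arc setting geo.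
have len u : s <= u <= t -> (curve_length g s u <= (a * d (g u))%:E)%E.
  move=> su; have s0 : 0 <= s by lra.
  apply: le_trans (curve_length_suffix g u s0) _.
  by apply: cone; rewrite in_itv/=; lra.
have low u : s <= u <= t -> d (g s) / (1 + a) <= d (g u).
  move=> su; rewrite ler_pdivrMr; last lra.
  have : mdist (g u) (g s) <= a * d (g u).
    rewrite metric_sym -lee_fin; apply: le_trans (len _ su).
    by apply: mdist_le_curve_length; lra.
  have : d (g s) <= d (g u) + mdist (g u) (g s).
    by case: setting => *; exact: bdist_lipschitz.
  lra.
have st' : s <= t by lra.
rewrite -lee_fin; apply: le_trans (qh_le setting _ _ _ low) _.
- split=> //; apply: continuous_subspaceW gcont => z /=; rewrite !in_itv/=; lra.
- by apply: le_lt_trans (len t _) _; rewrite ?ltry// lexx andbT.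
- by rewrite divr_gt0//; lra.
apply: (@le_trans _ _ ((d (g s) / (1 + a))^-1%:E * (a * d (g t))%:E)%E).
  by apply: lee_pmul; rewrite ?lee_fin ?invr_ge0 ?divr_ge0 ?curve_length_ge0 ?(ltW (d0 _))//;
    [lra|apply: len; lra].
rewrite -EFinM lee_fin invf_div mulrAC ler_pdivrMr//.
have aa : 0 <= a * (1 + a) by rewrite mulr_ge0//; lra.
by have := ler_wpM2l aa dts; lra.
Qed.

(** The cone condition is oriented towards [x0], so the two orders of [s] and [t] are treated apart;
    the hypothesis is used only at the later point. *)
Lemma john_subarc_bound : qh_subarc_bound Xbar k (2 * a * (1 + a)) x0.
Proof.
move=> x g geo s t; rewrite !in_itv/= => sK tK.
have [st|ts] := leP s t => dst.
  have dt : d (g t) <= 2 * Num.min (d (g s)) (d (g t)).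
    by apply: dst; rewrite in_itv/= st lexx.
  apply: (john_ordered_subarc_bound geo); [lra|lra|].
  by apply: (le_trans dt); rewrite ler_pM2l// ge_min lexx.
have ds : d (g s) <= 2 * Num.min (d (g s)) (d (g t)).
  by apply: dst; rewrite in_itv/= ltW//= lexx.
rewrite (metric_dist_sym k); apply: (john_ordered_subarc_bound geo); [lra|lra|].
by apply: (le_trans ds); rewrite ler_pM2l// ge_min lexx orbT.
Qed.

End JohnImpliesBounds.

Definition john_constant (R : realType) (A : R) (n : nat) : R :=
  8 * dip_ratio A * (2 * (scale_time A n + 1)).

Section BoundsImplyJohn.
Context {R : realType} {X : metricType R} (Xbar : completion X) (k : metric_on R X).
Variables (A : R) (x0 : X) (n : nat).
Hypotheses (setting : qh_setting Xbar k) (A_ge1 : 1 <= A)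
  (nA : 2 * dip_ratio A ^+ 2 <= 2 ^+ n)
  (diamA : diam_bound Xbar A x0) (subarcA : qh_subarc_bound Xbar k A x0).

Let d := bdist Xbar.

Lemma qh_geodesic_growth x g (u t : R) : qh_geodesic k x x0 g ->
  0 <= u <= t -> t <= k x x0 ->
  d (g u) <= 2 * dip_ratio A * expR (- (t - u) / (2 * (scale_time A n + 1))) * d (g t).
Proof.
move=> geo ut tK; have d0 z : 0 < d z by case: setting => *; exact: bdist_gt0.
apply: (@exponential_growth R A (k x x0) (d \o g)) => //=.
- by move=> v w vK wK; exact: qh_geodesic_harnack geo _ _ vK wK.
- move=> v _; have [_ -> _] := geo.
  (* The diameter bound enters here: with the Lipschitz property it gives the factor [1 + A] at the
     end [x0]. *)
  have : d (g v) <= d x0 + mdist x0 (g v).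
    by case: setting => *; exact: bdist_lipschitz.
  have : mdist x0 (g v) <= A * d x0.
    rewrite -lee_fin; apply: le_trans diamA; apply: ereal_sup_ubound.
    by exists (x0, g v).
  lra.
- move=> s v sv vK dsv.
  have sK0 : 0 <= s <= k x x0 by lra.
  have vK0 : 0 <= v <= k x x0 by lra.
  have sv' : s <= v by lra.
  have : k (g s) (g v) <= A.
    apply: (subarcA geo); rewrite ?in_itv//= => w.
    rewrite min_l// max_r// in_itv/= => /dsv[ws wv].
    by rewrite minr_pMr// le_min ws wv.
  by rewrite (qh_geodesic_dist geo sK0 vK0) ler0_norm; lra.
Qed.

Lemma qh_geodesic_cone x g : qh_geodesic k x x0 g ->
  cone_arc Xbar (john_constant A n) g 0 (k x x0).
Proof.
move=> geo; split; first exact: (qh_geodesic_is_arc setting geo).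
move=> t; rewrite in_itv/= => t0K.
have A1 := A_ge1; have d0 z : 0 < d z by case: setting => *; exact: bdist_gt0.
pose tau := 2 * (scale_time A n + 1); pose B := 2 * dip_ratio A.
have tau2 : 2 <= tau.
  by have := scale_time_ge A1 n; rewrite /tau; lra.
have B0 : 0 < B.
  by rewrite /B /dip_ratio mulr_gt0// mulr_gt0 ?expR_gt0//; lra.
have JE : john_constant A n = 4 * B * tau by rewrite /john_constant /B /tau; lra.
have J0 : 0 <= john_constant A n.
  by rewrite JE mulr_ge0; lra.
(* Up to constants, [H] is a primitive of the exponential bound on [d (g u)], which in turn bounds
   the speed of [g]. *)
pose H u := john_constant A n * d (g t) * expR (- (t - u) / tau).
apply: (@le_trans _ _ (H t - H 0)%:E); last first.
  rewrite lee_fin /H subrr oppr0 mul0r expR0 mulr1.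
  by rewrite lerBlDr lerDl mulr_ge0 ?expR_ge0// mulr_ge0 ?(ltW (d0 _)).
apply: (@curve_length_le_increment R X g H).
apply: (@increment_local_to_global R X g H _ _ 2^-1) => // u v uv vt vu.
have uK : 0 <= u <= k x x0 by lra.
have vK : 0 <= v <= k x x0 by lra.
have vu0 : 0 <= v - u by lra.
have := qh_geodesic_mdist setting geo vK uK; rewrite ger0_norm// metric_sym.
move=> /(_ vu) /le_trans; apply.
have tK : t <= k x x0 by lra.
have := qh_geodesic_growth geo (_ : 0 <= v <= t) tK.
rewrite -/tau -/B => /(_ ltac:(lra)) dv.
pose E := expR (- (t - v) / tau).
pose y := (v - u) / tau.
have y0 : 0 <= y by rewrite divr_ge0//; lra.
have y1 : y <= 1 by rewrite ler_pdivrMr; lra.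
have Eu : expR (- (t - u) / tau) = E * expR (- y).
  by rewrite -expRD /y; congr expR; field; lra.
(* Since (1 - y/2)(1 + y) = 1 + y(1 - y)/2 is at least 1. The lost factor 1/2 is why
   [john_constant A n] is [4 * B * tau], although the local speed bound has only a factor 2. *)
have ey : expR (- y) <= 1 - y / 2.
  rewrite expRN -[leLHS]div1r ler_pdivrMr ?expR_gt0//.
  have y2 : 0 <= 1 - y / 2 by lra.
  have := ler_wpM2l y2 (expR_ge1Dx y).
  have : 0 <= y * (1 - y) by rewrite mulr_ge0//; lra.
  lra.
rewrite /H Eu -/E.
have vuE : v - u = tau * y by rewrite /y; field; lra.
have E0 : 0 < E by exact: expR_gt0.
have cE0 : 0 <= john_constant A n * d (g t) * E.
  by rewrite mulr_ge0 ?(ltW E0)// mulr_ge0 ?(ltW (d0 _)).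
have := ler_wpM2l cE0 ey.
have vud : (v - u) * d (g v) <= (v - u) * (B * E * d (g t)) by exact: ler_wpM2l.
rewrite JE vuE in vud *; lra.
Qed.

End BoundsImplyJohn.
Lemma john_constant_ge1 (R : realType) (A : R) n : 1 <= A -> 1 <= john_constant A n.
Proof.
move=> A1; have T := scale_time_ge A1 n.
have e1 : 1 <= expR (2 * A) by have := expR_ge1Dx (2 * A); lra.
have C1 : 1 <= dip_ratio A by rewrite /dip_ratio; apply: mulr_ege1; lra.
by rewrite /john_constant; apply: mulr_ege1; lra.
Qed.

Theorem theorem1p2 (R : realType) :
  (forall (X : metricType R) (Xbar : completion X) (k : metric_on R X) (x0 : X),
     qh_setting Xbar k ->
     (exists a : R, 1 <= a /\ qh_john Xbar k a x0) <->
     (exists A : R, 1 <= A /\ diam_bound Xbar A x0 /\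
                    qh_subarc_bound Xbar k A x0))
  /\
  (forall a : R, 1 <= a -> exists A : R, 1 <= A /\
     forall (X : metricType R) (Xbar : completion X) (k : metric_on R X) (x0 : X),
       qh_setting Xbar k -> qh_john Xbar k a x0 ->
       diam_bound Xbar A x0 /\ qh_subarc_bound Xbar k A x0)
  /\
  (forall A : R, 1 <= A -> exists a : R, 1 <= a /\
     forall (X : metricType R) (Xbar : completion X) (k : metric_on R X) (x0 : X),
       qh_setting Xbar k ->
       diam_bound Xbar A x0 -> qh_subarc_bound Xbar k A x0 ->
       qh_john Xbar k a x0).
Proof.
have john_bounds (a : R) : 1 <= a -> exists A : R, 1 <= A /\
    forall (X : metricType R) (Xbar : completion X) (k : metric_on R X) (x0 : X),
    qh_setting Xbar k -> qh_john Xbar k a x0 ->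
    diam_bound Xbar A x0 /\ qh_subarc_bound Xbar k A x0.
  move=> a1; exists (2 * a * (1 + a)); split; first by apply: mulr_ege1; lra.
  move=> X Xbar k x0 setting john; split.
    exact: (john_diam_bound setting a1 john).
  exact: (john_subarc_bound setting a1 john).
have bounds_john (A : R) : 1 <= A -> exists a : R, 1 <= a /\
    forall (X : metricType R) (Xbar : completion X) (k : metric_on R X) (x0 : X),
    qh_setting Xbar k -> diam_bound Xbar A x0 -> qh_subarc_bound Xbar k A x0 ->
    qh_john Xbar k a x0.
  (* The number of octaves depends on [A] alone; any [N] above the required ratio works, as N is at
     most 2^N. *)
  move=> A1; pose N := Num.bound (2 * dip_ratio A ^+ 2).
  have nA : 2 * dip_ratio A ^+ 2 <= 2 ^+ N.
    apply/ltW/(@lt_le_trans _ _ N%:R).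
      by apply: archi_boundP; rewrite mulr_ge0// sqr_ge0.
    by rewrite -natrX ler_nat ltnW// ltn_expl.
  exists (john_constant A N); split; first exact: john_constant_ge1.
  move=> X Xbar k x0 setting diamA subarcA x g geo.
  exact: (qh_geodesic_cone setting A1 nA diamA subarcA geo).
split=> // X Xbar k x0 setting; split.
- move=> [a [a1 john]]; have [A [A1 bounds]] := john_bounds a a1.
  by exists A; split=> //; exact: bounds setting john.
- move=> [A [A1 [diamA subarcA]]]; have [a [a1 john]] := bounds_john A A1.
  by exists a; split=> //; exact: john setting diamA subarcA.
Qed.
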